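(* As $n\to\infty$, $$\mathrm{ex}(n,\mathbf B\mathbf C\mathbf D)=\tfrac14 n^2\bigl(1-o(1)\bigr).$$
   Context: A triple system on a finite vertex set $V$, $|V|=n$, is a family of distinct $3$-element subsets (triples) of $V$. We write $124$ for $\{1,2,4\}$ etc. $\mathbf B=\{125,134,234\}$ (on 5 vertices), $\mathbf C=\{124,134,234\}$ (on 4 vertices), $\mathbf D=\{123,134,235\}$ (on 5 vertices). A triple system contains a configuration if some of its triples form a system isomorphic to it (not necessarily induced). $\mathrm{ex}(n,X_1\dots X_k)$ denotes the maximum number of triples in a triple system on $n$ vertices that contains none of $X_1,\dots,X_k$. *)

(* Defs.v *)
From mathcomp Require Import all_boot.

Set Implicit Arguments.
Unset Strict Implicit.
Unset Printing Implicit Defensive.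

Definition triple_system (T : finType) (H : {set {set T}}) : bool :=
  [forall e in H, #|e| == 3].

(* A not necessarily induced copy of F in H: relabelling the vertices
   injectively sends the triples of F to some of the triples of H. *)
Definition contains (T U : finType) (H : {set {set T}}) (F : {set {set U}}) :
    bool :=
  [exists f : {ffun U -> T},
     injectiveb f && ([set f @: e | e : {set U} in F] \subset H)].

Record configuration := Configuration {
  vertices : nat;
  triples : {set {set 'I_vertices}}
}.

Definition ex (n : nat) (Xs : seq configuration) : nat :=
  \max_(H : {set {set 'I_n}} |
        triple_system H && all (fun X => ~~ contains H (triples X)) Xs) #|H|.

(* The triple abc on the labels 1, ..., k.+1; label i is the ordinal of
   value i.-1. *)
Definition triple (k a b c : nat) : {set 'I_k.+1} :=
  [set inord a.-1; inord b.-1; inord c.-1].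

Definition confB : configuration :=
  @Configuration 5 [set triple 4 1 2 5; triple 4 1 3 4; triple 4 2 3 4].

Definition confC : configuration :=
  @Configuration 4 [set triple 3 1 2 4; triple 3 1 3 4; triple 3 2 3 4].

Definition confD : configuration :=
  @Configuration 5 [set triple 4 1 2 3; triple 4 1 3 4; triple 4 2 3 5].

(* Main.v *)
Require Import Defs.
From HB Require Import structures.
From mathcomp Require Import all_boot all_order all_algebra.
From mathcomp Require Import all_classical all_reals all_analysis.
From mathcomp Require Import fintype finset zify ring lra.
Import Order.TTheory GRing.Theory Num.Theory.
Import numFieldNormedType.Exports.

Set Implicit Arguments.
Unset Strict Implicit.
Unset Printing Implicit Defensive.

(** Call a pair of vertices private if exactly one triple contains it.

    Upper bound.  In a system without C and D, at most one of the three pairs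
    of a triple lies in a second triple: if both xz and yz extend from xyz to
    further triples xzu and yzv, then the three triples form a copy of C when
    u = v and of D when u and v differ.  So every triple owns at least two
    private pairs, different triples own different ones, and the number of
    triples is at most half the number of pairs, about n^2/4
    ([two_private], [card_le_half_pairs]).

    Lower bound.  The counting argument is tight when nearly all pairs are
    private and every triple has exactly two of them; the triples then group
    into books, a book being a non-private pair (its spine) together with all
    third vertices (its pages), and avoiding B and C forces the pages of a
    book to be pairwise uncovered.  To have few uncovered pairs, all books draw their pages
    from a fixed family of blocks.  Take 2m blocks, each a copy of Z/r, and
    group block 2p with block 2p+1.  For every p and every block j > 2p+1, the
    r disjoint pairs joining (2p, x) to (2p+1, x + j) are spines, and the whole
    of block j is the page set of each of them.  If 2m <= r, different
    j give different shifts, so that a spine determines its page block, and a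
    pair of vertices in different groups is private.  Consequently the vertices
    of a triple lie in three different blocks, not all in one group, and
    two triples that share a pair share it inside a group and have their
    third vertices in a common block ([books_block_neq],
    [books_shared_pair]); this excludes B, C and D.  There are m(m-1)r^2
    triples on 2mr vertices, a proportion 1 - 1/m of n^2/4.

    Taking r to be n/2m rounded down, the two bounds give
    n^2 (1 - 2/m) <= 4 ex(n) <= n^2 as soon as n >= 4m^2
    ([ex_asymptotic_ge], [ex_le]), and m is arbitrary. *)

(** * Copies of the three configurations *)

Section Copies.
Variables (T : finType) (H : {set {set T}}).

Lemma imset_triple k a b c (f : 'I_k.+1 -> T) :
  f @: triple k a b c = [set f (inord a.-1); f (inord b.-1); f (inord c.-1)].
Proof. by rewrite /triple !imsetU !imset_set1. Qed.

Lemma contains3P k (t1 t2 t3 : {set 'I_k.+1}) :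
  reflect (exists2 f : 'I_k.+1 -> T, injective f &
             [/\ f @: t1 \in H, f @: t2 \in H & f @: t3 \in H])
          (contains H [set t1; t2; t3]).
Proof.
apply: (iffP existsP) => [[f /andP[/injectiveP finj /subsetP fH]]|].
  by exists f => //; split; apply: fH; apply: imset_f; rewrite !inE eqxx ?orbT.
case=> f finj [f1 f2 f3]; exists [ffun i => f i]; apply/andP; split.
  by apply/injectiveP => i j; rewrite !ffunE => /finj.
have ffE (t : {set 'I_k.+1}) : [ffun i => f i] @: t = f @: t.
  by apply: eq_imset => i; rewrite ffunE.
by apply/subsetP => _ /imsetP[t + ->]; rewrite ffE !inE =>
  /orP[/orP[]|] /eqP ->.
Qed.

Lemma inord_neq k i j : (i <= k)%N -> (j <= k)%N -> i != j ->
  (inord i : 'I_k.+1) != inord j.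
Proof.
by move=> ik jk; apply: contra_neq => /(congr1 (@nat_of_ord _)); rewrite !inordK.
Qed.

Lemma containsB_elim : contains H (triples confB) ->
  exists x1 x2 x3 x4 x5 : T, uniq [:: x1; x2; x3; x4; x5] /\
    [/\ [set x1; x2; x5] \in H, [set x1; x3; x4] \in H & [set x2; x3; x4] \in H].
Proof.
case/contains3P => f finj; rewrite !imset_triple => fH.
exists (f (inord 0)), (f (inord 1)), (f (inord 2)), (f (inord 3)), (f (inord 4)).
by split=> //; rewrite /= !inE !(inj_eq finj) !negb_or !inord_neq.
Qed.

Lemma containsC_elim : contains H (triples confC) ->
  exists x1 x2 x3 x4 : T, uniq [:: x1; x2; x3; x4] /\
    [/\ [set x1; x2; x4] \in H, [set x1; x3; x4] \in H & [set x2; x3; x4] \in H].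
Proof.
case/contains3P => f finj; rewrite !imset_triple => fH.
exists (f (inord 0)), (f (inord 1)), (f (inord 2)), (f (inord 3)).
by split=> //; rewrite /= !inE !(inj_eq finj) !negb_or !inord_neq.
Qed.

Lemma containsD_elim : contains H (triples confD) ->
  exists x1 x2 x3 x4 x5 : T, uniq [:: x1; x2; x3; x4; x5] /\
    [/\ [set x1; x2; x3] \in H, [set x1; x3; x4] \in H & [set x2; x3; x5] \in H].
Proof.
case/contains3P => f finj; rewrite !imset_triple => fH.
exists (f (inord 0)), (f (inord 1)), (f (inord 2)), (f (inord 3)), (f (inord 4)).
by split=> //; rewrite /= !inE !(inj_eq finj) !negb_or !inord_neq.
Qed.

Lemma nth_ord_inj k (s : seq T) x0 : size s = k -> uniq s ->
  injective (fun i : 'I_k => nth x0 s i).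
Proof.
by move=> sk us i j /eqP; rewrite nth_uniq ?sk // => /eqP /val_inj.
Qed.

Lemma containsC_intro (x1 x2 x3 x4 : T) : uniq [:: x1; x2; x3; x4] ->
  [set x1; x2; x4] \in H -> [set x1; x3; x4] \in H -> [set x2; x3; x4] \in H ->
  contains H (triples confC).
Proof.
move=> ux H1 H2 H3; apply/contains3P.
exists (fun i : 'I_4 => nth x1 [:: x1; x2; x3; x4] i); first exact: nth_ord_inj.
by rewrite !imset_triple !inordK.
Qed.

Lemma containsD_intro (x1 x2 x3 x4 x5 : T) : uniq [:: x1; x2; x3; x4; x5] ->
  [set x1; x2; x3] \in H -> [set x1; x3; x4] \in H -> [set x2; x3; x5] \in H ->
  contains H (triples confD).
Proof.
move=> ux H1 H2 H3; apply/contains3P.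
exists (fun i : 'I_5 => nth x1 [:: x1; x2; x3; x4; x5] i); first exact: nth_ord_inj.
by rewrite !imset_triple !inordK.
Qed.

End Copies.

(** * Upper bound: private pairs *)

Section UpperBound.
Variables (T : finType) (H : {set {set T}}).
Hypothesis H3 : triple_system H.
Hypothesis HC : ~~ contains H (triples confC).
Hypothesis HD : ~~ contains H (triples confD).

Definition private (P : {set T}) :=
  (#|P| == 2) && (#|[set e in H | P \subset e]| == 1).

Lemma set3C12 (x y z : T) : [set x; y; z] = [set y; x; z].
Proof. by rewrite (setUC [set x]). Qed.

Lemma set3C23 (x y z : T) : [set x; y; z] = [set x; z; y].
Proof. by rewrite -!setUA (setUC [set y]). Qed.

Lemma set3_rot (x y z : T) : [set x; y; z] = [set y; z; x].
Proof. by rewrite -setUA setUC. Qed.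

Lemma not_private_extend (x y z : T) : uniq [:: x; y; z] ->
  [set x; y; z] \in H -> ~~ private [set x; y] ->
  exists2 w, uniq [:: x; y; z; w] & [set x; y; w] \in H.
Proof.
move=> ux xyzH; rewrite /private cards2.
have xNy : x != y by move: ux; rewrite /= inE negb_or -andbA => /andP[].
rewrite xNy /= => Np.
have xyz_in : [set x; y; z] \in [set e in H | [set x; y] \subset e].
  by rewrite inE xyzH subsetUl.
have /existsP[e /and3P[eH sub eN]] :
    [exists e, [&& e \in H, [set x; y] \subset e & e != [set x; y; z]]].
  apply: contraR Np; rewrite negb_exists => /forallP all_eq.
  apply/eqP/esym/eqP; rewrite eq_sym; apply/cards1P; exists [set x; y; z].
  apply/eqP; rewrite eqEsubset sub1set xyz_in andbT.
  apply/subsetP => e; rewrite !inE => /andP[eH sub].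
  by move: (all_eq e); rewrite eH sub /= negbK.
have e3 : #|e| = 3 by move/forall_inP: H3 => /(_ e eH)/eqP.
have /cards1P[w ew] : #|e :\: [set x; y]| == 1.
  by rewrite cardsD (setIidPr sub) e3 cards2 xNy.
have eE : e = [set x; y; w].
  by rewrite -ew setDE setUIr setUCr setIT; apply/esym/setUidPr.
have : w \in e :\: [set x; y] by rewrite ew inE.
rewrite !inE negb_or => /andP[/andP[wx wy] _].
exists w; last by rewrite -eE.
have wz : w != z by apply: contraNneq eN => <-; rewrite eE.
move: ux; rewrite /= !inE !negb_or !andbT (eq_sym x w) (eq_sym y w) (eq_sym z w).
by rewrite wx wy wz !andbT.
Qed.

(** The step that uses the forbidden configurations: second triples xzu and
    yzv on the pairs xz and yz form, with xyz, a copy of C if u = v, in which z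
    is the vertex of degree three, and of D otherwise. *)
Lemma private_or (x y z : T) : uniq [:: x; y; z] ->
  [set x; y; z] \in H -> private [set x; z] || private [set y; z].
Proof.
move=> ux xyzH; apply/orP; case: (boolP (private [set x; z])); first by left.
move=> Nxz; right; apply: contraT => Nyz.
have ux1 : uniq [:: x; z; y]
  by move: ux; rewrite /= !inE !negb_or !andbT (eq_sym z) => /andP[/andP[-> ->] ->].
have ux2 : uniq [:: y; z; x] by rewrite -(rot_uniq 2).
have [u uu uH] : exists2 w, uniq [:: x; z; y; w] & [set x; z; w] \in H.
  by apply: not_private_extend => //; rewrite set3C23.
have [v uv vH] : exists2 w, uniq [:: y; z; x; w] & [set y; z; w] \in H.
  by apply: not_private_extend => //; rewrite set3C23 set3C12.
move: uu uv; rewrite /= !inE !negb_or !andbT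
  => /and3P[/and3P[xz xy xu] /andP[zy zu] yu]
     /and3P[/and3P[yz yx yv] /andP[zx zv] xv].
have [E|uNv] := eqVneq u v.
  case/negP: HC; apply: (@containsC_intro _ _ x y u z).
  - by rewrite /= !inE !negb_or xy xu xz yu yz [u == z]eq_sym zu.
  - by [].
  - by rewrite set3C23.
  - by rewrite set3C23 E.
case/negP: HD; apply: (@containsD_intro _ _ x y z u v) => //.
by rewrite /= !inE !negb_or xy xz xu xv yz yu yv zu zv uNv.
Qed.

Lemma card3_eq (e : {set T}) : #|e| = 3 ->
  exists x y z, uniq [:: x; y; z] /\ e = [set x; y; z].
Proof.
rewrite cardE; have := enum_uniq e; have := mem_enum e.
case: (enum e) => [|x [|y [|z []]]] // eE ue _.
by exists x, y, z; split=> //; apply/setP => t; rewrite -eE !inE orbA.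
Qed.

Lemma two_private_of_common (x y z : T) : x != y ->
  private [set x; z] -> private [set y; z] ->
  (2 <= #|[set P | private P & P \subset [set x; y; z]]|)%N.
Proof.
move=> xNy xz yz; have PNQ : [set x; z] != [set y; z].
  apply: contraNneq xNy => E; have : x \in [set y; z] by rewrite -E set21.
  rewrite !inE => /orP[//|/eqP xEz].
  by move: xz; rewrite /private xEz cards2 eqxx.
have <- : #|[set [set x; z]; [set y; z]]| = 2 by rewrite cards2 PNQ.
apply: subset_leq_card.
apply/subsetP => P; rewrite !inE => /orP[] /eqP ->; rewrite ?xz ?yz /=.
  by rewrite set3C23 subsetUl.
by rewrite set3_rot subsetUl.
Qed.

(** Among three pairs, any two of which include a private one, at least two
    are private; the cases only say which two. *)
Lemma two_private e : e \in H -> (2 <= #|[set P | private P & P \subset e]|)%N.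
Proof.
move=> eH; have /eqP/card3_eq[x [y [z [u eE]]]] := forall_inP H3 e eH.
have u' : uniq [:: y; z; x] by rewrite -(rot_uniq 2).
have u'' : uniq [:: z; x; y] by rewrite -(rot_uniq 1).
have P1 : private [set x; z] || private [set y; z].
  by apply: private_or; rewrite -?eE.
have P2 : private [set y; x] || private [set z; x].
  by apply: private_or => //; rewrite -set3_rot -eE.
have P3 : private [set z; y] || private [set x; y].
  by apply: private_or => //; rewrite set3_rot -eE.
rewrite (setUC [set y]) (setUC [set z]) in P2; rewrite (setUC [set z]) in P3.
have [xNy xNz yNz] : [/\ x != y, x != z & y != z].
  by move: u; rewrite /= !inE negb_or andbT -andbA => /and3P.
rewrite eE.
case: (boolP (private [set x; z])) P1 P2 => [xz _ _|_ /= yz].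
  case/orP: P3 => [yz|xy]; first exact: two_private_of_common.
  by rewrite set3_rot; apply: two_private_of_common => //; rewrite setUC.
rewrite orbF => xy; rewrite set3_rot set3_rot.
by apply: two_private_of_common; rewrite 1?eq_sym // setUC // eq_sym.
Qed.

(** Double counting of the incidences between triples and the private pairs
    inside them. *)
Lemma card_le_half_pairs : (2 * #|H| <= 'C(#|T|, 2))%N.
Proof.
rewrite mulnC -sum_nat_const -card_draws.
apply: (@leq_trans (\sum_(e in H) #|[set P | private P & P \subset e]|)).
  exact: leq_sum two_private.
under eq_bigr => e eH do rewrite -sum1_card.
rewrite (exchange_big_dep private) /=; last by move=> e P _; rewrite inE => /andP[].
have -> : #|[set P : {set T} | #|P| == 2]| = \sum_(P : {set T} | #|P| == 2) 1.
  by rewrite -sum1_card; apply: eq_bigl => P; rewrite inE.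
rewrite [leqRHS](bigID (fun P : {set T} => #|[set e in H | P \subset e]| == 1)) /=.
apply: leq_trans (leq_addr _ _); apply: leq_sum => P privP.
have /andP[_ /eqP priv1] := privP; rewrite -[leqRHS]priv1 -sum1_card.
by apply: eq_leq; apply: eq_bigl => e; rewrite !inE privP.
Qed.

End UpperBound.

(** * Lower bound: books with common page blocks *)

(** Vertices are natural numbers: [v %/ r] is the block of [v], [v %% r] its
    position inside the block, and [(v %/ r)./2] its group. *)
Section Construction.
Variables r m : nat.
(* Shifts by different block numbers are then different modulo r. *)
Hypothesis room : m.*2 <= r.

(** [w] is a page of the book with spine [uv]: the shift from [u] to [v] encodes
    the block from which the pages are taken. *)
Definition page (u v w : nat) : bool :=
  [&& ~~ odd (u %/ r), v %/ r == (u %/ r).+1, v %/ r < w %/ r, w %/ r < m.*2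
    & v %% r == (u %% r + w %/ r) %% r].

Definition books n : {set {set 'I_n}} :=
  [set [set t.1.1; t.1.2; t.2] | t : 'I_n * 'I_n * 'I_n & page t.1.1 t.1.2 t.2].

Lemma booksP n (e : {set 'I_n}) :
  reflect (exists u v w : 'I_n, page u v w /\ e = [set u; v; w]) (e \in books n).
Proof.
apply: (iffP imsetP) => [[[[u v] w]]|[u [v [w [uvw ->]]]]].
  by rewrite inE /= => uvw ->; exists u, v, w.
by exists (u, v, w); rewrite ?inE.
Qed.

Lemma page_block u v w : page u v w ->
  [/\ v %/ r = (u %/ r).+1, (u %/ r)./2 = (v %/ r)./2 & (v %/ r)./2 < (w %/ r)./2].
Proof.
case/and5P; move: (u %/ r) (v %/ r) (w %/ r) => a b c ea /eqP -> ac _ _.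
by split; lia.
Qed.

Lemma page_lt u v w : page u v w -> u < v < w.
Proof.
case/and5P => _ /eqP vu vw _ _.
apply/andP; split; rewrite ltnNge; apply/negP => /(leq_div2r r).
  by rewrite vu ltnn.
by rewrite leqNgt vw.
Qed.

(** The spine determines the page block; the next two lemmas say that a page
    together with one end of the spine determines the other end. *)
Lemma page_inj_block u v w w' : page u v w -> page u v w' -> w %/ r = w' %/ r.
Proof.
case/and5P => _ _ _ wm /eqP v1 /and5P[_ _ _ wm' /eqP v2].
have /eqP : (u %% r + w %/ r) %% r = (u %% r + w' %/ r) %% r by rewrite -v1.
by rewrite eqn_modDl !modn_small;
  [move/eqP | exact: leq_trans room | exact: leq_trans room].
Qed.

Lemma page_inj_right u v v' w : page u v w -> page u v' w -> v = v'.
Proof.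
case/and5P => _ /eqP v1 _ _ /eqP v2 /and5P[_ /eqP v3 _ _ /eqP v4].
by rewrite (divn_eq v r) (divn_eq v' r) v1 v3 v2 v4.
Qed.

Lemma page_inj_left u u' v w : page u v w -> page u' v w -> u = u'.
Proof.
case/and5P => _ /eqP v1 _ wm /eqP v2 /and5P[_ /eqP v3 _ _ /eqP v4].
rewrite (divn_eq u r) (divn_eq u' r); congr (_ * _ + _).
  by move: v1; rewrite v3 => -[].
have /eqP : (u %% r + w %/ r) %% r = (u' %% r + w %/ r) %% r by rewrite -v2.
by rewrite eqn_modDr !modn_mod => /eqP.
Qed.

(** The three roles that a pair can play in a triple: a spine, or a page with
    the even or with the odd end of the spine.  The blocks of [x] and [y] alone
    tell which one. *)
Lemma books_pair n (x y w : 'I_n) : uniq [:: x; y; w] ->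
  [set x; y; w] \in books n -> x < y ->
  [\/ page x y w, page x w y | page w x y].
Proof.
rewrite /= !inE negb_or andbT => /andP[/andP[xNy xNw] yNw].
case/booksP => u [v [t [uvt E]]].
have [xE yE wE] :
  [/\ x \in [set u; v; t], y \in [set u; v; t] & w \in [set u; v; t]].
  by rewrite -E !inE !eqxx !orbT.
have /andP[uv vt] := page_lt uvt.
move: xE yE wE xNy xNw yNw; rewrite !inE.
case/orP=> [/orP[]|] /eqP -> /orP[/orP[]|] /eqP -> /orP[/orP[]|] /eqP ->;
  rewrite ?eqxx // => _ _ _ lt; try lia.
- by constructor 1.
- by constructor 2.
- by constructor 3.
Qed.

Lemma books_block_neq n (x y w : 'I_n) : uniq [:: x; y; w] ->
  [set x; y; w] \in books n -> x %/ r != y %/ r.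
Proof.
wlog xy : x y / x < y => [IH|] u xyw.
  have [lt|lt|/val_inj E] := ltngtP x y; first exact: IH.
    rewrite eq_sym; apply: IH => //; last by rewrite set3C12.
    by move: u; rewrite /= !inE !negb_or (eq_sym y x) !andbT => /andP[/andP[-> ->] ->].
  by move: u; rewrite E /= !inE eqxx.
have [] := books_pair u xyw xy => /page_block [];
  by move: (x %/ r) (y %/ r) (w %/ r) => a b c; lia.
Qed.

(** Two triples on a pair [xy] give it the same role, which depends only on the
    blocks.  If the pair is a spine, both third vertices lie in its page block;
    in the other two roles the third vertex would be unique. *)
Lemma books_shared_pair n (x y w w' : 'I_n) :
  uniq [:: x; y; w; w'] ->
  [set x; y; w] \in books n -> [set x; y; w'] \in books n ->
  (x %/ r)./2 = (y %/ r)./2 /\ w %/ r = w' %/ r.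
Proof.
wlog xy : x y / x < y => [IH|u e1 e2].
  move=> u e1 e2; have [lt|lt|/val_inj E] := ltngtP x y; first exact: IH.
    suff [-> ->] : (y %/ r)./2 = (x %/ r)./2 /\ w %/ r = w' %/ r by [].
    apply: IH; rewrite // 1?set3C12 //.
    by move: u; rewrite /= !inE !negb_or (eq_sym y x) !andbT =>
      /and3P[/and3P[-> -> ->] /andP[-> ->] ->].
  by move: u; rewrite E /= !inE eqxx.
have [u1 u2 wNw'] : [/\ uniq [:: x; y; w], uniq [:: x; y; w'] & w != w'].
  by move: u; rewrite /= !inE !negb_or !andbT =>
    /and3P[/and3P[-> -> ->] /andP[-> ->] ->].
(* The six cases with different roles contradict each other on blocks. *)
have [p1|p1|p1] := books_pair u1 e1 xy; have [p2|p2|p2] := books_pair u2 e2 xy;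
  try by exfalso; case: (page_block p1) (page_block p2); clear;
    move: (x %/ r) (y %/ r) (w %/ r) (w' %/ r) => a b c d ? ? ? [? ? ?]; lia.
- by have [_ ? _] := page_block p1; split=> //; apply: page_inj_block p2.
- by case/eqP: wNw'; apply/val_inj/(page_inj_right p1 p2).
- by case/eqP: wNw'; apply/val_inj/(page_inj_left p1 p2).
Qed.

Lemma books_triple_system n : triple_system (books n).
Proof.
apply/forall_inP => _ /booksP[u [v [w [/page_lt/andP[uv vw] ->]]]].
rewrite setUC cardsU1 cards2 !inE -!val_eqE /= negb_or.
by rewrite (gtn_eqF vw) (gtn_eqF (ltn_trans uv vw)) (ltn_eqF uv).
Qed.

(** The triples 134 and 234 put 1 and 2 in a common block, so 125 cannot be a
    triple. *)
Lemma books_B_free n : ~~ contains (books n) (triples confB).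
Proof.
apply/negP => /containsB_elim[x1 [x2 [x3 [x4 [x5 [u [e125 e134 e234]]]]]]].
have := u; rewrite /= !inE !negb_or !andbT
  => /and4P[/and4P[n12 n13 n14 n15] /and3P[n23 n24 n25] /andP[n34 _] _].
have [_ E] : (x3 %/ r)./2 = (x4 %/ r)./2 /\ x1 %/ r = x2 %/ r.
  apply: books_shared_pair; rewrite -1?set3_rot //.
  by rewrite /= !inE !negb_or n34 !(eq_sym x3) n13 n23 !(eq_sym x4) n14 n24 n12.
have /negP[] : x1 %/ r != x2 %/ r; last by rewrite E.
by apply: books_block_neq e125; rewrite /= !inE negb_or n12 n15 n25.
Qed.

(** Here 124 and 134 put 2 and 3 in a common block, against 234. *)
Lemma books_C_free n : ~~ contains (books n) (triples confC).
Proof.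
apply/negP => /containsC_elim[x1 [x2 [x3 [x4 [u [e124 e134 e234]]]]]].
have := u; rewrite /= !inE !negb_or !andbT
  => /and3P[/and3P[n12 n13 n14] /andP[n23 n24] n34].
have [_ E] : (x1 %/ r)./2 = (x4 %/ r)./2 /\ x2 %/ r = x3 %/ r.
  apply: books_shared_pair; rewrite 1?set3C23 //.
  by rewrite /= !inE !negb_or n14 n12 n13 !(eq_sym x4) n24 n34 n23.
have /negP[] : x2 %/ r != x3 %/ r; last by rewrite E.
by apply: books_block_neq e234; rewrite /= !inE negb_or n23 n24 n34.
Qed.

(** The shared pairs 13 and 23 put 1, 2 and 3 in a common group, which has
    only two blocks. *)
Lemma books_D_free n : ~~ contains (books n) (triples confD).
Proof.
apply/negP => /containsD_elim[x1 [x2 [x3 [x4 [x5 [u [e123 e134 e235]]]]]]].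
have := u; rewrite /= !inE !negb_or !andbT
  => /and4P[/and4P[n12 n13 n14 n15] /and3P[n23 n24 n25] /andP[n34 n35] n45].
have [g13 _] : (x1 %/ r)./2 = (x3 %/ r)./2 /\ x2 %/ r = x4 %/ r.
  apply: books_shared_pair; rewrite // 1?set3C23 //.
  by rewrite /= !inE !negb_or n12 n13 n14 (eq_sym x3) n23 n34 n24.
have [g23 _] : (x2 %/ r)./2 = (x3 %/ r)./2 /\ x1 %/ r = x5 %/ r.
  apply: books_shared_pair; rewrite // -1?set3_rot //.
  by rewrite /= !inE !negb_or !(eq_sym _ x1) n12 n13 n23 n25 n35 n15.
have b12 : x1 %/ r != x2 %/ r.
  by apply: books_block_neq e123; rewrite /= !inE !negb_or n12 n13 n23.
have b13 : x1 %/ r != x3 %/ r.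
  apply: (@books_block_neq _ _ _ x2); rewrite 1?set3C23 //.
  by rewrite /= !inE !negb_or n12 n13 eq_sym n23.
have b23 : x2 %/ r != x3 %/ r.
  apply: (@books_block_neq _ _ _ x1); rewrite -1?set3_rot //.
  by rewrite /= !inE !negb_or !(eq_sym _ x1) n12 n13 n23.
move: g13 g23 b12 b13 b23; clear.
by move: (x1 %/ r) (x2 %/ r) (x3 %/ r) => a b c; lia.
Qed.

Lemma sum_ord_gt N a : \sum_(j < N | a < j) 1 = N - a.+1.
Proof.
elim: N => [|N IH]; first by rewrite big_ord0.
by rewrite big_mkcond big_ord_recr -big_mkcond /= IH; case: ltnP; lia.
Qed.

Lemma sum_spines k : \sum_(p < k) (k.*2 - p.*2.+2) = k * k.-1.
Proof.
elim: k => [|k IH]; first by rewrite big_ord0.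
rewrite big_ord_recl /= /bump /=.
under eq_bigr => i _ do rewrite add1n !doubleS 2!subSS.
by rewrite IH; case: k {IH} => // k; lia.
Qed.

(* The data ((p, j), (x, z)) of a triple: the group of the spine, the block of
   the page, the position of the even end of the spine and that of the page. *)
Local Notation page_index := ('I_m * 'I_m.*2 * ('I_r * 'I_r))%type.

Lemma card_page_index :
  #|[set t : page_index | t.1.1.*2.+1 < t.1.2]|
    = m * m.-1 * r ^ 2.
Proof.
set E := [set s : 'I_m * 'I_m.*2 | s.1.*2.+1 < s.2].
have -> : [set t : page_index | t.1.1.*2.+1 < t.1.2] = setX E setT.
  by apply/setP => t; rewrite !inE andbT.
rewrite cardsX cardsT card_prod card_ord mulnn -sum_spines; congr (_ * _).
rewrite -sum1_card (eq_bigl (fun s : 'I_m * 'I_m.*2 => s.1.*2.+1 < s.2)); last first.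
  by move=> s; rewrite inE.
rewrite -(pair_big_dep xpredT
  (fun (p : 'I_m) (j : 'I_m.*2) => p.*2.+1 < j) (fun _ _ => 1)).
by apply: eq_bigr => p _; rewrite sum_ord_gt.
Qed.

Lemma set3_ltn_inj n (u v w u' v' w' : 'I_n) :
  u < v -> v < w -> u' < v' -> v' < w' ->
  [set u; v; w] = [set u'; v'; w'] -> [/\ u = u', v = v' & w = w'].
Proof.
move=> uv vw uv' vw' E.
have mem x : x \in [set u; v; w] ->
    [|| x == u' :> nat, x == v' :> nat | x == w' :> nat].
  by rewrite E !inE -!val_eqE orbA.
have := mem u; have := mem v; have := mem w.
rewrite !inE !eqxx !orbT => /(_ isT) w_in /(_ isT) v_in /(_ isT) u_in.
by split; apply: val_inj => /=; lia.
Qed.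

Lemma card_books n : m.*2 * r <= n -> m * m.-1 * r ^ 2 <= #|books n|.
Proof.
case: n => [|n] Hn.
  have: (m == 0) || (r == 0) by move: Hn; rewrite leqn0 muln_eq0 double_eq0.
  move=> mr0; suff /eqP-> : m * m.-1 * r ^ 2 == 0 by [].
  move: mr0; rewrite !muln_eq0.
  by case/orP => ->; rewrite ?orbT.
rewrite -card_page_index.
pose vtx b x : 'I_n.+1 := inord (b * r + x).
pose left (t : page_index) := vtx t.1.1.*2 t.2.1.
pose right (t : page_index) :=
  vtx t.1.1.*2.+1 ((t.2.1 + t.1.2) %% r).
pose outer (t : page_index) := vtx t.1.2 t.2.2.
pose spread t := [set left t; right t; outer t].
have vtxK b x : b < m.*2 -> x < r -> (vtx b x %/ r = b) * (vtx b x %% r = x).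
  move=> bm xr; rewrite inordK.
    by rewrite divnMDl ?modnMDl ?modn_small ?divn_small ?addn0 //; case: (r) xr.
  apply: leq_trans Hn.
  apply: (@leq_trans (b.+1 * r)); last by rewrite leq_mul2r bm orbT.
  by rewrite mulSn addnC ltn_add2r.
have pageP (t : page_index) : t.1.1.*2.+1 < t.1.2 ->
    page (left t) (right t) (outer t).
  case: t => [[p j] [x z]] /= pj.
  have r0 : 0 < r by case: (r) x => [[]|].
  have [[[pm jm] xr] zr] := (ltn_ord p, ltn_ord j, ltn_ord x, ltn_ord z).
  rewrite /page /left /right /outer /= !vtxK ?ltn_pmod //; try lia.
rewrite -(@card_in_imset _ _ spread).
  apply/subset_leq_card/subsetP => _ /imsetP[t + ->]; rewrite inE => /pageP tp.
  by apply/booksP; exists (left t), (right t), (outer t).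
move=> t t'; rewrite !inE => lt lt'.
have [uv vw] := andP (page_lt (pageP t lt)).
have [uv' vw'] := andP (page_lt (pageP t' lt')).
case/(set3_ltn_inj uv vw uv' vw') => eq_left _ eq_outer.
case: t t' lt lt' eq_left eq_outer {uv vw uv' vw'}
  => [[p j] [x z]] [[p' j'] [x' z']] /= _ _ eq_left eq_outer.
have p2 (q : 'I_m) : q.*2 < m.*2 by rewrite ltn_double.
move: (congr1 (fun v : 'I__ => v %/ r) eq_left)
  (congr1 (fun v : 'I__ => v %% r) eq_left).
move: (congr1 (fun v : 'I__ => v %/ r) eq_outer)
  (congr1 (fun v : 'I__ => v %% r) eq_outer).
rewrite /left /outer /= !vtxK //.
by move=> /val_inj -> /val_inj -> /double_inj /val_inj -> /val_inj ->.
Qed.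

End Construction.

(** * The extremal number *)

Lemma ex_le n : 4 * ex n [:: confB; confC; confD] <= n ^ 2.
Proof.
have le2 : ex n [:: confB; confC; confD] <= 'C(n, 2) %/ 2.
  apply/bigmax_leqP => H /andP[H3] /= /and4P[_ HC HD _].
  by rewrite leq_divRL // mulnC -[n in 'C(n, _)]card_ord card_le_half_pairs.
move: le2; rewrite leq_divRL // bin2 => le2.
have := leq_trunc_div (n * n.-1) 2; rewrite -divn2 in le2.
have : n * n.-1 <= n ^ 2 by rewrite -mulnn leq_mul2l leq_pred orbT.
lia.
Qed.

Lemma ex_ge n m r : m.*2 <= r -> m.*2 * r <= n ->
  m * m.-1 * r ^ 2 <= ex n [:: confB; confC; confD].
Proof.
move=> room fit; apply: leq_trans (card_books room fit) _.
apply: (leq_bigmax_cond (F := fun H : {set {set 'I_n}} => #|H|)).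
by rewrite books_triple_system /= books_B_free // books_C_free // books_D_free.
Qed.

Lemma sqr_le_near N d n : N <= n -> n <= N + d -> n ^ 2 <= N ^ 2 + d * (n + n).
Proof.
by move=> Nn nNd; rewrite -leq_subLR subn_sqr leq_mul // ?leq_add2l // leq_subLR.
Qed.

(** With r = n/2m rounded down, the construction covers 2mr > n - 2m vertices.
    Both the rounding and the pairs lost inside the groups cost a share 1/m of
    n^2, which together make the term 2 n^2. *)
Lemma ex_asymptotic_ge n m : 0 < m -> 4 * m ^ 2 <= n ->
  m * n ^ 2 <= 4 * m * ex n [:: confB; confC; confD] + 2 * n ^ 2.
Proof.
move=> m0 mn; set r := n %/ m.*2.
have d0 : 0 < m.*2 by rewrite double_gt0.
have room : m.*2 <= r.
  by rewrite leq_divRL //; apply: leq_trans mn; rewrite -mulnn -mul2n; lia.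
have fit : m.*2 * r <= n by rewrite mulnC leq_trunc_div.
have ceil : n <= m.*2 * r + m.*2 by rewrite addnC -mulnS mulnC ltnW // ltn_ceil.
have rounding : m * n ^ 2 <= m * (m.*2 * r) ^ 2 + n ^ 2.
  apply: (@leq_trans (m * ((m.*2 * r) ^ 2 + m.*2 * (n + n)))).
    by rewrite leq_mul2l sqr_le_near ?orbT.
  rewrite mulnDr leq_add2l -[n ^ 2]mulnn.
  have -> : m * (m.*2 * (n + n)) = (4 * m ^ 2) * n by rewrite -mulnn -mul2n; lia.
  by rewrite leq_mul2r mn orbT.
have few_lost : m * (m.*2 * r) ^ 2 = 4 * m * (m * m.-1 * r ^ 2) + (m.*2 * r) ^ 2.
  by case: (m) m0 => //= k _; rewrite -!mulnn -mul2n; lia.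
have := leq_mul (leqnn (4 * m)) (ex_ge room fit).
have : (m.*2 * r) ^ 2 <= n ^ 2 by rewrite leq_sqr.
by move: rounding; rewrite few_lost; clear; lia.
Qed.

(** * The limit *)

Local Open Scope classical_set_scope.
Local Open Scope ring_scope.

Theorem theorem22 (R : realType) :
  exists o : nat -> R,
    (o @ \oo --> (0 : R)) /\
    forall n : nat,
      (ex n [:: confB; confC; confD])%:R = 1 / 4 * n%:R ^+ 2 * (1 - o n) :> R.
Proof.
(* At n = 0 division by zero makes this 1, harmless since ex 0 = 0. *)
exists (fun n => 1 - 4 * (ex n [:: confB; confC; confD])%:R / n%:R ^+ 2).
split=> [|[|n]].
- apply/cvgrPdist_le => eps eps0.
  near=> n.
  (* Any m > 2 / eps will do: the error is at most 2 / m once n >= 4 m^2. *)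
  pose m := (Num.truncn (2 / eps)).+1.
  have n0 : (0 < n)%N by near: n; exact: nbhs_infty_gt.
  have nm : (4 * m ^ 2 <= n)%N by near: n; exact: nbhs_infty_ge.
  have m_gt : 2 / eps < m%:R :> R by rewrite truncnS_gt.
  have := ex_asymptotic_ge (ltn0Sn _ : (0 < m)%N) nm; have := ex_le n.
  move: (ex _ _) => E upper lower.
  have n2 : 0 < n%:R ^+ 2 :> R by rewrite exprn_gt0 // ltr0n.
  have m_pos : 0 < m%:R :> R by rewrite ltr0n.
  rewrite sub0r normrN ger0_norm; last first.
    by rewrite subr_ge0 ler_pdivrMr // mul1r -natrX -natrM ler_nat.
  rewrite lerBlDl -lerBlDr ler_pdivlMr //.
  have lower' : m%:R * n%:R ^+ 2 <= 4 * m%:R * E%:R + 2 * n%:R ^+ 2 :> R.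
    by rewrite -natrX -!natrM -natrD ler_nat.
  have me : 2 <= m%:R * eps by rewrite -ler_pdivrMr // ltW.
  rewrite -(ler_pM2l m_pos); nra.
- have := ex_le 0; rewrite exp0n // leqn0 muln_eq0 /= => /eqP ->.
  by rewrite expr0n /= mulr0 mul0r.
- have n0 : n.+1%:R != 0 :> R by rewrite pnatr_eq0.
  by field.
Unshelve. all: by end_near.
Qed.
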